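(* For any integers $0\leq m\leq n$ and any nonnegative integer $k$, $$\sum_{i=0}^{m}\binom{n}{i}=\sum_{i_1=0}^{k}\sum_{i_2=k}^{m+k}(-1)^{i_1}\binom{k}{i_1}\binom{n+k-i_1}{i_2}.$$
   Context: For integers $a,b\geq 0$, $\binom{a}{b}$ is the usual binomial coefficient, with $\binom{a}{b}=0$ if $b>a$. *)

(* Defs.v *)
From mathcomp Require Export all_boot all_order all_algebra.

(* Main.v *)
Require Import Defs.
From mathcomp Require Import all_boot all_order all_algebra.

Import GRing.Theory.

Local Open Scope ring_scope.

(* For fixed j = i2 - k, the sum over i1 is the coefficient of X^(j + k) in
   (1 + X)^n ((1 + X) - 1)^k = (1 + X)^n X^k, namely 'C(n, j). *)

(** Swapping the sums and putting [i2 = j + k] splits the claim into one identity for each [j],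
    [alternating_sum_bin]. That identity compares coefficients in the binomial expansion of ['X^k],
    seen as a power of [(1 + 'X) - 1]. *)

Lemma coef_exp1DX (R : nzRingType) (n j : nat) :
  ((1 + 'X : {poly R}) ^+ n)`_j = 'C(n, j)%:R.
Proof.
have -> : (1 + 'X : {poly R}) ^+ n = \poly_(i < n.+1) 'C(n, i)%:R.
  rewrite poly_def exprDn_comm; last exact: commr_sym (commr1 _).
  by apply: eq_bigr => i _; rewrite expr1n mul1r scaler_nat.
by rewrite coef_poly ltnS; case: leqP => // /bin_small ->.
Qed.

Lemma alternating_sum_bin (n k j : nat) :
  \sum_(0 <= i < k.+1)
     (-1 : int) ^+ i * 'C(k, i)%:Z * 'C(n + k - i, j + k)%:Z = 'C(n, j)%:Z.
Proof.
have XkE : (1 + 'X : {poly int}) ^+ n * 'X^k =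
    \sum_(i < k.+1) ((-1) ^+ i * 'C(k, i)%:Z) *: (1 + 'X) ^+ (n + k - i).
  rewrite -{2}['X](addKr 1 'X) [- 1 + _]addrC exprBn mulr_sumr.
  apply: eq_bigr => i _; have le_ik : (i <= k)%N by rewrite -ltnS.
  (* Truncated subtraction is harmless: [i <= k] gives [n + k - i = n + (k - i)]. *)
  rewrite expr1n mulr1 -addnBA // exprD -scalerA -[_%:Z]natz scaler_nat.
  (* The sign is a polynomial on the left and an integer scalar on the right; the parity of [i]
     settles both. *)
  rewrite -[in LHS]signr_odd -[in RHS]signr_odd scaler_sign mulrnAr.
  by case: (odd i); rewrite ?mul1r // mulN1r mulrN mulNrn.
have := congr1 (fun p : {poly int} => p`_(j + k)) XkE.
rewrite /= coefMXn ltnNge leq_addl addnK coef_exp1DX natz /= => ->.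
rewrite coef_sum big_mkord; apply: eq_bigr => i _.
by rewrite coefZ coef_exp1DX natz.
Qed.

Theorem mainTheorem7 (m n k : nat) (le_mn : (m <= n)%N) :
  \sum_(0 <= i < m.+1) ('C(n, i)%N)%:Z =
  \sum_(0 <= i1 < k.+1) \sum_(k <= i2 < (m + k).+1)
     (-1 : int) ^+ i1 * ('C(k, i1)%N)%:Z * ('C((n + k - i1)%N, i2)%N)%:Z.
Proof.
(* The bounds become [0 + k] and [m.+1 + k], so that [big_addn] can shift the index by [k]. *)
rewrite exchange_big_nat /= -{1}[in RHS](add0n k) -addSn big_addn addnK.
by apply: eq_bigr => j _; rewrite alternating_sum_bin.
Qed.
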